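(* Every $(D,L)$-Bonnet-Myers sharp graph $G=(V,E)$ satisfies $$\inf_{x\in V}\mathcal K^{\mathrm n}_{G,x}(\infty)\le\frac1D+\frac1L.$$
   Context: All graphs are finite, simple, undirected, unweighted, connected, and have at least one edge. $d$ denotes the combinatorial distance and $\mathrm{diam}(G)=\max_{x,y}d(x,y)$; $x\sim y$ means that $x,y$ are adjacent. For a $D$-regular graph $G=(V,E)$ and $x\in V$, let $\mu_x$ be the probability measure on $V$ giving mass $\frac1{D+1}$ to $x$ and to each of its $D$ neighbours. The Wasserstein distance of probability measures $\mu,\nu$ on $V$ is $W_1(\mu,\nu)=\inf_\pi\sum_{u,v\in V}d(u,v)\pi(u,v)$, where $\pi:V\times V\to[0,1]$ runs over all couplings with marginals $\mu$ and $\nu$. The (modified) Ollivier Ricci curvature of two different vertices $x,y$ is $$\kappa(x,y)=\frac{D+1}{D}\left(1-\frac{W_1(\mu_x,\mu_y)}{d(x,y)}\right).$$ A $D$-regular graph $G$ of diameter $L$ is called $(D,L)$-Bonnet-Myers sharp if $\inf_{x\sim y}\kappa(x,y)=\frac2L$. Normalized Bakry-Émery $\infty$-curvature: let $\Delta f(x)=\frac1D\sum_{y\sim x}(f(y)-f(x))$ for $f:V\to\mathbb R$, and $2\Gamma(f,g)=\Delta(fg)-f\Delta g-g\Delta f$, $2\Gamma_2(f,g)=\Delta\Gamma(f,g)-\Gamma(f,\Delta g)-\Gamma(\Delta f,g)$, $\Gamma(f)=\Gamma(f,f)$, $\Gamma_2(f)=\Gamma_2(f,f)$. Then $\mathcal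 K^{\mathrm n}_{G,x}(\infty)$ is the largest real number $\mathcal K$ such that $\Gamma_2(f)(x)\ge\mathcal K\,\Gamma(f)(x)$ for all $f:V\to\mathbb R$. *)

(* Defs.v *)
From HB Require Import structures.
From mathcomp Require Import all_boot all_order all_algebra.
From mathcomp Require Import ring lra.
From mathcomp Require Import boolp classical_sets reals.

Set Implicit Arguments.
Unset Strict Implicit.
Unset Printing Implicit Defensive.

Import Order.TTheory GRing.Theory Num.Theory.

Local Open Scope classical_set_scope.
Local Open Scope ring_scope.

(* A graph on a finite vertex type [T] is given by its adjacency relation. *)
Definition simple_graph (T : finType) (e : rel T) : Prop :=
  symmetric e /\ irreflexive e.

Definition connected_graph (T : finType) (e : rel T) : Prop :=
  forall x y : T, connect e x y.

Definition has_edge (T : finType) (e : rel T) : Prop :=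
  exists x y : T, e x y.

Definition regular_graph (T : finType) (e : rel T) (D : nat) : Prop :=
  forall x : T, #|[set y | e x y]%SET| = D.

Definition walk (T : finType) (e : rel T) (x y : T) (n : nat) : bool :=
  [exists p : n.-tuple T, path e x p && (last x p == y)].

(* The least length of a walk from [x] to [y]; a shortest walk has fewer than
   #|T| edges, and the value is the dummy #|T| if [y] is unreachable. *)
Definition gdist (T : finType) (e : rel T) (x y : T) : nat :=
  find (walk e x y) (iota 0 #|T|).

Definition diam (T : finType) (e : rel T) : nat :=
  (\max_(x : T) \max_(y : T) gdist e x y)%N.

Section Curvature.
Variables (R : realType) (T : finType) (e : rel T).

Definition mu (D : nat) (x : T) : T -> R :=
  fun y => if (y == x) || e x y then (D.+1%:R)^-1 else 0.

Definition coupling (m n : T -> R) (pi : T -> T -> R) : Prop :=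
  [/\ forall u v, 0 <= pi u v <= 1,
      forall u, \sum_v pi u v = m u &
      forall v, \sum_u pi u v = n v].

Definition W1 (m n : T -> R) : R :=
  inf [set \sum_u \sum_v (gdist e u v)%:R * pi u v | pi in coupling m n].

(* Meant for distinct vertices [x], [y] only. *)
Definition kappa (D : nat) (x y : T) : R :=
  D.+1%:R / D%:R * (1 - W1 (mu D x) (mu D y) / (gdist e x y)%:R).

Definition bonnet_myers_sharp (D L : nat) : Prop :=
  [/\ regular_graph e D, diam e = L &
      inf [set k | exists x y, e x y /\ k = kappa D x y] = 2 / L%:R].

Definition Lap (D : nat) (f : T -> R) : T -> R :=
  fun x => D%:R^-1 * \sum_(y | e x y) (f y - f x).

Definition Gam (D : nat) (f g : T -> R) : T -> R :=
  fun x => (Lap D (fun y => f y * g y) x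
            - f x * Lap D g x - g x * Lap D f x) / 2.

Definition Gam2 (D : nat) (f g : T -> R) : T -> R :=
  fun x => (Lap D (Gam D f g) x
            - Gam D f (Lap D g) x - Gam D (Lap D f) g x) / 2.

Definition BE_bound (D : nat) (x : T) : set R :=
  [set K | forall f : T -> R, Gam2 D f f x >= K * Gam D f f x].

(* This supremum is attained: see [BE_curvature_max]. *)
Definition BE_curvature (D : nat) (x : T) : R := sup (BE_bound D x).

End Curvature.

Arguments BE_bound R {T} e D x.

Lemma walkP (T : finType) (e : rel T) (x y : T) (n : nat) :
  reflect (exists2 p : seq T, path e x p & (last x p = y) /\ size p = n)
          (walk e x y n).
Proof.
apply: (iffP existsP) => [[p /andP[ep /eqP lp]]|[p ep [lp sp]]].
  by exists p => //; rewrite size_tuple.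
have sp' : size p == n by apply/eqP.
by exists (Tuple sp'); rewrite /= ep lp eqxx.
Qed.

Lemma gdistP (T : finType) (e : rel T) (x y : T) : connect e x y ->
  walk e x y (gdist e x y) /\
  (forall n, walk e x y n -> (gdist e x y <= n)%N).
Proof.
move=> /connectP[q eq ly].
have hasw : has (walk e x y) (iota 0 #|T|).
  case/shortenP: eq ly => p ep up _ ly.
  apply/hasP; exists (size p); last by apply/walkP; exists p.
  rewrite mem_iota add0n /=.
  by have := max_card [in x :: p]; rewrite (card_uniqP up).
have lt : (gdist e x y < #|T|)%N.
  by rewrite /gdist -[X in (_ < X)%N](size_iota 0) -has_find.
split; first by have := nth_find 0%N hasw; rewrite nth_iota.
move=> n wn; rewrite leqNgt; apply/negP => ltn.
have := before_find 0%N ltn.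
by rewrite nth_iota ?(ltn_trans ltn lt)// add0n wn.
Qed.

Section Attained.
Variables (R : realType) (T : finType) (e : rel T) (D : nat).
Hypotheses (irr : irreflexive e) (reg : regular_graph e D) (D0 : (0 < D)%N).

Let sum_cst (x : T) (c : R) : D%:R^-1 * \sum_(y | e x y) c = c.
Proof.
rewrite sumr_const; have -> : #|[pred y | e x y]| = D.
  by rewrite -(reg x); apply: eq_card => y; rewrite !inE.
by rewrite -[c *+ D]mulr_natl mulrA mulVf ?mul1r// pnatr_eq0 -lt0n.
Qed.

Lemma GamE (f g : T -> R) (x : T) : Gam e D f g x =
  D%:R^-1 * \sum_(y | e x y) ((f y - f x) * (g y - g x) / 2).
Proof.
rewrite /Gam /Lap (mulrCA (f x)) (mulrCA (g x)) -!mulrBr -mulrA; congr (_ * _).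
rewrite !mulr_sumr -!sumrB mulr_suml; apply: eq_bigr => y _; ring.
Qed.

Lemma BE_bound_ge (x : T) : BE_bound R e D x (-1).
Proof.
move=> f; rewrite /Gam2.
have Gs (h k : T -> R) : Gam e D h k x = Gam e D k h x.
  rewrite !GamE; congr (_ * _); apply: eq_bigr => y _.
  by rewrite (mulrC (h y - _)).
rewrite (Gs (Lap e D f)).
pose G := Gam e D f f; rewrite -/G.
pose a y := f y - f x.
suff: - G x - G x <= Lap e D G x - 2 * Gam e D f (Lap e D f) x by lra.
have Dge : 0 <= D%:R^-1 :> R by rewrite invr_ge0.
have LG : Lap e D G x = D%:R^-1 * (\sum_(y | e x y) G y) - G x.
  by rewrite /Lap sumrB mulrBr (sum_cst x (G x)).
have GL : 2 * Gam e D f (Lap e D f) x =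
    D%:R^-1 * (\sum_(y | e x y) a y * Lap e D f y) - (Lap e D f x) ^+ 2.
  have -> : Lap e D f x ^+ 2 =
      D%:R^-1 * (\sum_(y | e x y) a y * Lap e D f x).
    by rewrite -mulr_suml mulrA expr2.
  rewrite GamE (mulrCA 2) -mulrBr; congr (_ * _).
  rewrite mulr_sumr -sumrB; apply: eq_bigr => y _; rewrite /a.
  by set u := Lap e D f y; set v := Lap e D f x; lra.
have key : Lap e D G x - 2 * Gam e D f (Lap e D f) x =
   D%:R^-1 * (\sum_(y | e x y) (G y - a y * Lap e D f y))
   - G x + (Lap e D f x) ^+ 2.
  by rewrite LG GL sumrB mulrBr; ring.
rewrite key.
have h : - G x <= D%:R^-1 * (\sum_(y | e x y) (G y - a y * Lap e D f y)).
  rewrite /G {1}GamE -mulrN ler_wpM2l// -sumrN ler_sum// => y _.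
  rewrite -[leLHS](sum_cst y) GamE /Lap (mulrCA (a y)) -mulrBr ler_wpM2l//.
  rewrite mulr_sumr -sumrB ler_sum// => z _.
  rewrite -/(a y); set b := f z - f y.
  by have := sqr_ge0 (a y - b); rewrite expr2; lra.
by have := sqr_ge0 (Lap e D f x); lra.
Qed.

Lemma BE_curvature_max (x : T) :
  BE_bound R e D x (BE_curvature R e D x) /\
  ubound (BE_bound R e D x) (BE_curvature R e D x).
Proof.
have ne : BE_bound R e D x !=set0 by exists (-1); exact: BE_bound_ge.
have Gge (f : T -> R) : 0 <= Gam e D f f x.
  rewrite GamE mulr_ge0 ?invr_ge0// sumr_ge0// => y _.
  by have := sqr_ge0 (f y - f x); rewrite expr2; lra.
have bnd (f : T -> R) : 0 < Gam e D f f x ->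
    ubound (BE_bound R e D x) (Gam2 e D f f x / Gam e D f f x).
  by move=> G0 K bK; rewrite ler_pdivlMr//; exact: bK.
have hub : has_ubound (BE_bound R e D x).
  pose f y : R := (y == x)%:R.
  exists (Gam2 e D f f x / Gam e D f f x); apply: bnd.
  rewrite GamE (eq_bigr (fun=> 1 / 2)); first by rewrite sum_cst; lra.
  move=> y exy; rewrite /f eqxx; case: eqP => [yx|_]; last first.
    by rewrite sub0r mulrNN !mul1r.
  by rewrite yx irr in exy.
split; last by move=> K; exact: (ub_le_sup hub).
move=> f; have [G0|] := ltP 0 (Gam e D f f x).
  by rewrite -ler_pdivlMr//; apply: (ge_sup ne); exact: bnd.
move=> Gle; have G0 : Gam e D f f x = 0 by apply/eqP; rewrite eq_le Gle Gge.
by have := @BE_bound_ge x f; rewrite G0 !mulr0.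
Qed.

End Attained.

(* Main.v *)
Require Import Defs.
From mathcomp Require Import all_boot all_order all_algebra.
From mathcomp Require Import ring lra zify.
From mathcomp Require Import boolp classical_sets reals.

(** The distance function f = d(x, .) from a vertex x realising the diameter
    is used both to control the transport distance from below and to test the
    Bakry-Emery inequality at x.

    Transport.  Integrating a 1-Lipschitz f against a coupling gives
    W1 (mu_u, mu_v) >= int f dmu_v - int f dmu_u, and int f dmu_u equals
    f u + D / (D + 1) * Lap f u.  Hence if every edge has curvature at least k,
    Lap f drops by at least k along each edge on which f increases by one
    ([Lap_edge_drop]), thus by k * d(u, v) along a geodesic from u to v on which
    f increases steadily ([Lap_geodesic_drop]).

    Rigidity.  Let d(x, y) = L and k = 2 / L.  The Laplacian of d(y, .) is 1
    at y and is never below -1, so the total drop 2 along a geodesic from y to x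
    leaves no slack: it is exactly -1 at x.  All neighbours z of x are therefore
    at distance L - 1 from y, that is, on a geodesic from x to y.  Following
    f = d(x, .) along the remaining L - 1 edges from z to y, where Lap f >= -1,
    yields Lap f z >= 1 - 2 / L ([sharp_Lap_neighbour]).

    Bakry-Emery.  Gam2 f at x involves only the values of Lap f on the
    neighbours of x ([Gam2_dist]), and a large Lap f there makes Gam2 f small:
    few edges join two neighbours of x.  Quantitatively the curvature at x is at
    most 1 / 2 + 1 / D - a / 2 whenever Lap f >= a on the neighbours of x
    ([BE_curvature_le_dist]); a = 1 - 2 / L gives 1 / D + 1 / L. *)

Set Implicit Arguments.
Unset Strict Implicit.
Unset Printing Implicit Defensive.

Import Order.TTheory GRing.Theory Num.Theory.

Local Open Scope classical_set_scope.
Local Open Scope ring_scope.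

(** * Graph distance *)

Section Distance.
Variables (T : finType) (e : rel T).
Hypotheses (sym : symmetric e) (irr : irreflexive e).
Hypothesis conn : connected_graph e.

Local Notation d := (gdist e).

Lemma gdist_le_path (x : T) (p : seq T) :
  path e x p -> (d x (last x p) <= size p)%N.
Proof.
by move=> ep; apply: (gdistP (conn _ _)).2; apply/walkP; exists p.
Qed.

Lemma gdist_path (x y : T) :
  exists p, [/\ path e x p, last x p = y & size p = d x y].
Proof.
by have /walkP[p ep [lp sp]] := (gdistP (conn x y)).1; exists p.
Qed.

Lemma gdistxx (x : T) : d x x = 0%N.
Proof. by have := @gdist_le_path x [::] isT; rewrite leqn0 => /eqP. Qed.

Lemma gdist_eq0 (x y : T) : (d x y == 0%N) = (x == y).
Proof.
apply/eqP/eqP => [d0|->]; last exact: gdistxx.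
by have [[|z p] [_ lp]] := gdist_path x y; rewrite d0.
Qed.

Lemma gdist_triangle (x y z : T) : (d x z <= d x y + d y z)%N.
Proof.
have [p [ep lp <-]] := gdist_path x y; have [q [eq lq <-]] := gdist_path y z.
rewrite -size_cat -lq -lp -last_cat; apply: gdist_le_path.
by rewrite cat_path ep lp.
Qed.

Lemma gdist_sym (x y : T) : d x y = d y x.
Proof.
suff le u v : (d u v <= d v u)%N by apply/eqP; rewrite eqn_leq !le.
have [p [ep lp <-]] := gdist_path v u.
have h : path e u (rev (belast v p)).
  by rewrite -lp rev_path (eq_path (e' := e)) // => a b; exact: sym.
have <- : last u (rev (belast v p)) = v.
  by case: (p) lp => [//|a q] _; rewrite /= rev_cons last_rcons.
by rewrite (leq_trans (gdist_le_path h)) // size_rev size_belast.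
Qed.

Lemma gdist_edge (x y : T) : e x y -> d x y = 1%N.
Proof.
move=> exy; have := @gdist_le_path x [:: y]; rewrite /= exy => /(_ isT).
have : d x y != 0%N.
  by rewrite gdist_eq0; apply: contraTneq exy => ->; rewrite irr.
by case: (d x y) => [|[|]].
Qed.

Lemma gdist_edger (x u v : T) : e u v -> (d x v <= d x u + 1)%N.
Proof. by move=> /gdist_edge <-; exact: gdist_triangle. Qed.

Lemma gdist_stepl (x y : T) (n : nat) :
  d x y = n.+1 -> exists2 z, e x z & d z y = n.
Proof.
move=> dxy; have [[|z p] []] := gdist_path x y; first by rewrite dxy.
move=> /= /andP[exz ep] lp; rewrite dxy => -[sp].
exists z => //; apply/eqP; rewrite eqn_leq -{1}lp -{1}sp gdist_le_path //=.
by have := gdist_triangle x z y; rewrite dxy (gdist_edge exz) add1n ltnS.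
Qed.

Lemma gdist_le_diam (x y : T) : (d x y <= diam e)%N.
Proof.
by rewrite /diam (leq_trans _ (leq_bigmax x))// (leq_trans _ (leq_bigmax y)).
Qed.

Lemma diam_attained : has_edge e -> exists x y, d x y = diam e.
Proof.
case=> x0 _; have T0 : (0 < #|T|)%N by apply/card_gt0P; exists x0.
have [x hx] := @bigop.eq_bigmax T (fun x => \max_y d x y)%N T0.
have [y hy] := @bigop.eq_bigmax T (d x) T0.
by exists x, y; rewrite /diam hx hy.
Qed.

End Distance.

(** * Transport distance and the Laplacian *)

Section Transport.
Variables (R : realType) (T : finType) (e : rel T) (D : nat).
Hypotheses (sym : symmetric e) (irr : irreflexive e).
Hypothesis conn : connected_graph e.
Hypotheses (reg : regular_graph e D) (D0 : (0 < D)%N).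

Local Notation d := (gdist e).
Local Notation Lap := (Lap e D).
Local Notation mu := (mu R e D).
Local Notation dist x := (fun w : T => (gdist e x w)%:R : R).

Let Dne : D%:R != 0 :> R. Proof. by rewrite pnatr_eq0 -lt0n. Qed.
Let Dgt : 0 < D%:R :> R. Proof. by rewrite ltr0n. Qed.

Lemma avg_cst (x : T) (c : R) : D%:R^-1 * \sum_(y | e x y) c = c.
Proof.
rewrite sumr_const; have -> : #|[pred y | e x y]| = D.
  by rewrite -(reg x); apply: eq_card => y; rewrite !inE.
by rewrite -[c *+ D]mulr_natl mulrA mulVf ?mul1r.
Qed.

Lemma sum_mu (f : T -> R) (x : T) :
  \sum_y f y * mu x y = f x + D%:R / D.+1%:R * Lap f x.
Proof.
have -> : \sum_y f y * mu x y = \sum_(y | (y == x) || e x y) f y / D.+1%:R.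
  rewrite [RHS]big_mkcond; apply: eq_bigr => y _; rewrite /Defs.mu.
  by case: ifP; rewrite ?mulr0.
rewrite (bigD1 x) ?eqxx //=.
rewrite (eq_bigl (e x)) => [|y]; last first.
  by case: eqP => [->|]; rewrite ?irr //= andbT.
have -> : Lap f x = D%:R^-1 * (\sum_(y | e x y) f y) - f x.
  by rewrite /Defs.Lap sumrB mulrBr avg_cst.
rewrite -mulr_suml; set S := \sum_(y | e x y) f y.
have : D.+1%:R != 0 :> R by rewrite pnatr_eq0.
rewrite -[D.+1]addn1 natrD => D1ne.
by field; rewrite Dne D1ne.
Qed.

Lemma sum_mu1 (x : T) : \sum_y mu x y = 1.
Proof.
have := sum_mu (fun=> 1) x; under eq_bigr do rewrite mul1r.
by move=> ->; rewrite /Defs.Lap big1 ?mulr0 ?addr0// => y _; rewrite subrr.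
Qed.

Lemma mu_ge0 (x y : T) : 0 <= mu x y.
Proof. by rewrite /Defs.mu; case: ifP => // _; rewrite invr_ge0. Qed.

Lemma mu_le1 (x y : T) : mu x y <= 1.
Proof.
by rewrite /Defs.mu; case: ifP => // _; rewrite invf_le1 ?ler1n// ltr0n.
Qed.

(** The easy half of Kantorovich duality.  The product coupling makes the
    infimum range over a nonempty set. *)
Lemma W1_ge (f : T -> R) (x y : T) :
  (forall u v, f v - f u <= (d u v)%:R) ->
  \sum_w f w * mu y w - \sum_w f w * mu x w <= W1 e (mu x) (mu y).
Proof.
move=> lip; apply: lb_le_inf.
  exists (\sum_u \sum_v (d u v)%:R * (mu x u * mu y v)).
  exists (fun u v => mu x u * mu y v) => //; split.
  - by move=> u v; rewrite mulr_ge0 ?mu_ge0 //= mulr_ile1 ?mu_ge0 ?mu_le1.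
  - by move=> u; rewrite -mulr_sumr sum_mu1 mulr1.
  - by move=> v; rewrite -mulr_suml sum_mu1 mul1r.
move=> _ [pi [pi01 pil pir] <-].
have -> : \sum_w f w * mu y w = \sum_u \sum_v f v * pi u v.
  by rewrite exchange_big; apply: eq_bigr => v _; rewrite -mulr_sumr pir.
have -> : \sum_w f w * mu x w = \sum_u \sum_v f u * pi u v.
  by apply: eq_bigr => u _; rewrite -mulr_sumr pil.
rewrite -sumrB ler_sum // => u _; rewrite -sumrB ler_sum // => v _.
by rewrite -mulrBl ler_wpM2r //; case/andP: (pi01 u v).
Qed.

Lemma kappa_ge_inf (x y : T) : e x y ->
  inf [set k : R | exists x y, e x y /\ k = kappa R e D x y] <= kappa R e D x y.
Proof.
move=> exy; apply: ge_inf; last by exists x, y.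
exists (- \sum_u \sum_v `|kappa R e D u v|) => _ [u [v [_ ->]]].
rewrite lerNl (le_trans (y := `|kappa R e D u v|)) //.
  by rewrite -normrN ler_norm.
rewrite (bigD1 u) //= (bigD1 v) //= -addrA lerDl.
by rewrite addr_ge0 // sumr_ge0 // => w _; rewrite sumr_ge0.
Qed.

Lemma Lap_edge_drop (k : R) (f : T -> R) (u v : T) :
  (forall u v, f v - f u <= (d u v)%:R) ->
  e u v -> k <= kappa R e D u v -> f v = f u + 1 ->
  Lap f v <= Lap f u - k.
Proof.
move=> lip euv kk fv; have := W1_ge (f := f) u v lip.
move: kk; rewrite /kappa (gdist_edge irr conn euv) divr1 !sum_mu fv.
set W := W1 _ _ _; set a := Lap f u; set b := Lap f v.
have D1 : 0 < D.+1%:R :> R by rewrite ltr0n.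
rewrite mulrAC ler_pdivlMr // => kk.
rewrite (_ : _ - _ = 1 + (b - a) * D%:R / D.+1%:R); last by ring.
rewrite -lerBrDl ler_pdivrMr // => h.
have : (b - a) * D%:R <= - k * D%:R.
  by rewrite mulNr (le_trans h) // lerNr (le_trans kk)// lerNr; lra.
by rewrite ler_pM2r //; lra.
Qed.

Lemma dist_lip (x u v : T) : (d x v)%:R - (d x u)%:R <= (d u v)%:R :> R.
Proof. by rewrite lerBlDl -natrD ler_nat gdist_triangle. Qed.

(** The equality of distances places z on a geodesic from x to y.  It is
    inherited by the next vertex of a geodesic from z to y, which is what the
    induction on d(z, y) consumes, one [Lap_edge_drop] at a time. *)
Lemma Lap_geodesic_drop (k : R) (x y z : T) :
  (forall u v, e u v -> k <= kappa R e D u v) ->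
  (d x z + d z y = d x y)%N ->
  Lap (dist x) y <= Lap (dist x) z - (d z y)%:R * k.
Proof.
move=> hk; move Hn: (d z y) => n; elim: n z Hn => [|n IH] z dzy.
  move=> _; move/eqP: dzy; rewrite gdist_eq0 // => /eqP ->.
  by rewrite mul0r subr0.
move=> geo; have [w ezw dwy] := gdist_stepl irr conn dzy.
have dxw : d x w = (d x z + 1)%N.
  have := gdist_edger irr conn x ezw; have := gdist_triangle conn x w y.
  by lia.
have := IH w dwy; rewrite dxw -geo addn1 addSnnS => /(_ erefl) h.
have := @Lap_edge_drop k (dist x) z w (dist_lip x) ezw (hk _ _ ezw).
by rewrite dxw natrD => /(_ erefl) h'; rewrite -[n.+1]addn1 natrD; lra.
Qed.

Lemma Lap_dist_self (x : T) : Lap (dist x) x = 1.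
Proof.
rewrite /Defs.Lap (eq_bigr (fun=> 1)) ?avg_cst // => y exy.
by rewrite (gdist_edge irr conn exy) gdistxx // subr0.
Qed.

Lemma dist_edge_ge (x u v : T) : e u v -> -1 <= (d x v)%:R - (d x u)%:R :> R.
Proof.
rewrite sym => evu; have := gdist_edger irr conn x evu.
by rewrite -(ler_nat R) natrD; lra.
Qed.

Lemma Lap_dist_ge (x z : T) : -1 <= Lap (dist x) z.
Proof.
rewrite -[leLHS](avg_cst z) /Defs.Lap ler_wpM2l ?invr_ge0 // ler_sum // => v.
exact: dist_edge_ge.
Qed.

(** A vertex z at which the lower bound -1 is attained is a strict local
    maximum of d(x, .). *)
Lemma Lap_dist_min (x z v : T) :
  Lap (dist x) z <= -1 -> e z v -> (d x v)%:R = (d x z)%:R - 1 :> R.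
Proof.
move=> hz ezv; apply/eqP; rewrite -subr_eq0.
have term_ge0 w : e z w -> 0 <= (d x w)%:R - ((d x z)%:R - 1) :> R.
  by move=> /(dist_edge_ge x); lra.
have sum0 : \sum_(w | e z w) ((d x w)%:R - ((d x z)%:R - 1)) = 0 :> R.
  apply/eqP; rewrite eq_le sumr_ge0 // andbT -(pmulr_rle0 _ (x := D%:R^-1));
    last by rewrite invr_gt0.
  under eq_bigr do rewrite opprB addrCA addrC.
  by rewrite big_split mulrDr avg_cst -/(Lap (dist x) z); lra.
by apply/eqP; exact: (psumr_eq0P (fun w hw => term_ge0 w hw) sum0).
Qed.

Lemma sharp_Lap_neighbour (x y z : T) :
  (0 < d x y)%N ->
  (forall u v, e u v -> 2 / (d x y)%:R <= kappa R e D u v) ->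
  e x z -> 1 - 2 / (d x y)%:R <= Lap (dist x) z.
Proof.
set L := d x y => L0 hk exz.
have Lne : L%:R != 0 :> R by rewrite pnatr_eq0 -lt0n.
(* The drop along a full geodesic from y to x is 2, from 1 down to -1. *)
have min_x : Lap (dist y) x <= -1.
  have := Lap_geodesic_drop (x := y) (y := x) (z := y) hk.
  rewrite gdistxx // => /(_ erefl).
  rewrite Lap_dist_self (gdist_sym sym conn y x) -/L mulrCA divff //; lra.
have dzy : (d z y + 1 = L)%N.
  have := Lap_dist_min min_x exz.
  rewrite !(gdist_sym sym conn y) -/L => h.
  by apply/eqP; rewrite -(eqr_nat R) natrD h subrK.
have := Lap_geodesic_drop (x := x) (y := y) (z := z) hk.
rewrite (gdist_edge irr conn exz) addnC dzy => /(_ erefl).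
have -> : (d z y)%:R = L%:R - 1 :> R by rewrite -dzy natrD addrK.
rewrite mulrBl mulrCA divff // => h.
by have := Lap_dist_ge x y; lra.
Qed.

(** * The Bakry-Emery inequality for the distance function *)

Lemma Gam_dist_self (x : T) (g : T -> R) :
  Gam e D (dist x) g x = Lap g x / 2.
Proof.
rewrite GamE // /Defs.Lap -mulrA mulr_suml; congr (_ * _).
apply: eq_bigr => y exy.
by rewrite (gdist_edge irr conn exy) gdistxx // subr0 mul1r.
Qed.

(** On the neighbours w of z, the increment s = d(x, w) - 1 is -1, 0 or 1, and
    is -1 only at w = x; hence s ^ 2 = s + 2 * [w = x], which turns the energy
    of d(x, .) at z into its Laplacian. *)
Lemma Gam_dist_neighbour (x z : T) : e x z ->
  Gam e D (dist x) (dist x) z = Lap (dist x) z / 2 + D%:R^-1.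
Proof.
move=> exz; have ezx : e z x by rewrite sym.
have dxz := gdist_edge irr conn exz.
rewrite GamE // /Defs.Lap -mulrA mulr_suml.
rewrite -[X in _ + X]mulr1 -mulrDr; congr (_ * _).
rewrite (bigD1 x) //= [in RHS](bigD1 x) //= gdistxx // dxz.
rewrite [X in _ + X](_ : _ = \sum_(w | e z w && (w != x))
    ((d x w)%:R - 1%:R) / 2 :> R); first by lra.
apply: eq_bigr => w /andP[ezw wx].
have : (d x w <= 2)%N by have := gdist_edger irr conn x ezw; rewrite dxz.
have : d x w != 0%N by rewrite gdist_eq0 // eq_sym.
by case: (d x w) => [|[|[|]]] //= _ _; lra.
Qed.

Lemma Gam2_dist (x : T) :
  Gam2 e D (dist x) (dist x) x =
  (1 / 2 + D%:R^-1 - (D%:R^-1 * \sum_(z | e x z) Lap (dist x) z) / 2) / 2.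
Proof.
have GamC (f g : T -> R) : Gam e D f g x = Gam e D g f x.
  rewrite !GamE //; congr (_ * _); apply: eq_bigr => y _.
  by rewrite (mulrC (f y - _)).
have LapE (g : T -> R) : Lap g x = D%:R^-1 * (\sum_(z | e x z) g z) - g x.
  by rewrite /Defs.Lap sumrB mulrBr avg_cst.
rewrite /Gam2 (GamC (Lap _)) Gam_dist_self (LapE (Lap _)) (LapE (Gam e D _ _)).
rewrite Gam_dist_self Lap_dist_self.
rewrite (eq_bigr _ (@Gam_dist_neighbour x)) big_split /= mulrDr avg_cst.
by rewrite -mulr_suml mulrA; lra.
Qed.

Lemma BE_curvature_le_dist (x : T) (a : R) :
  (forall z, e x z -> a <= Lap (dist x) z) ->
  BE_curvature R e D x <= 1 / 2 + D%:R^-1 - a / 2.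
Proof.
move=> ha; have /(_ (dist x)) := (BE_curvature_max R irr reg D0 x).1.
rewrite Gam2_dist Gam_dist_self Lap_dist_self.
have : a <= D%:R^-1 * \sum_(z | e x z) Lap (dist x) z.
  by rewrite -[leLHS](avg_cst x) ler_wpM2l ?invr_ge0 // ler_sum.
by lra.
Qed.

Lemma inf_BE_curvature_le (x : T) :
  inf (range (BE_curvature R e D)) <= BE_curvature R e D x.
Proof.
apply: ge_inf; last by exists x.
exists (-1) => _ [z _ <-]; apply: (BE_curvature_max R irr reg D0 z).2.
exact: BE_bound_ge.
Qed.

End Transport.

Theorem theorem1p7 (R : realType) (T : finType) (e : rel T) (D L : nat)
    (hsimple : simple_graph e) (hconn : connected_graph e)
    (hedge : has_edge e) (hsharp : bonnet_myers_sharp R e D L) :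
  inf (range (BE_curvature R e D)) <= 1 / D%:R + 1 / L%:R.
Proof.
case: hsimple => sym irr; case: hsharp => reg diamL infL.
have [u [v euv]] := hedge.
have D0 : (0 < D)%N.
  by rewrite -(reg u); apply/card_gt0P; exists v; rewrite inE.
have L0 : (0 < L)%N.
  by rewrite -diamL (leq_trans _ (gdist_le_diam e u v)) // (gdist_edge irr).
have [x [y]] := diam_attained hedge; rewrite diamL => dxy.
have hk a b : e a b -> 2 / L%:R <= kappa R e D a b.
  by move=> eab; rewrite -infL; exact: kappa_ge_inf.
apply: (le_trans (inf_BE_curvature_le R irr reg D0 x)).
have lap z : e x z -> 1 - 2 / L%:R <= Lap e D (fun w => (gdist e x w)%:R : R) z.
  by move=> exz; rewrite -dxy; apply: sharp_Lap_neighbour; rewrite ?dxy.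
by have := BE_curvature_le_dist sym irr hconn reg D0 lap; lra.
Qed.
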